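(* Let $X\in\mathbb{R}^{L\times N}$, $P\in\mathbb{R}^{L\times N}$, let $\beta\ge 0$, and let $V\in\mathbb{R}^{N\times N}$ be the positive diagonal matrix described in the context. Then the $N\times N$ linear system $$A=\beta\left(V+\beta X^{T}X\right)^{-1}X^{T}P$$ is equivalent to the $L\times L$ linear system $$A=\beta\left(XV^{-1}\right)^{T}\left[I_{L}+\beta X\left(XV^{-1}\right)^{T}\right]^{-1}P,$$ where $I_L$ is the $L\times L$ identity matrix; that is, the two right-hand sides are the same matrix in $\mathbb{R}^{N\times N}$.
   Context: $X\in\mathbb{R}^{L\times N}$ is a data matrix with $N$ samples (columns) and $L$ features. The two formulas are updating rules for $A\in\mathbb{R}^{N\times N}$ in the problem $\min_{A}\|A\|_{2,1}+\frac{\beta}{2}\mathrm{Tr}\{(XA-P)^{T}(XA-P)\}$, where $\|A\|_{2,1}=\sum_{n}\|a^{n}\|_2$ and $a^n$ denotes the $n$-th row of $A$. In the updating rule, $V$ is a given diagonal matrix, computed from the rows $a^n$ of the current iterate (an arbitrary real $N\times N$ matrix): its $n$-th diagonal entry is $V_{nn}=\frac{1}{\sqrt{\|a^{n}\|_2^2+\epsilon}}>0$, with $\epsilon>0$ a fixed small constant. The matrix $V$ is held fixed in both formulas. *)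

(* Defs.v *)
From mathcomp Require Import all_boot all_order all_algebra.
Set Implicit Arguments.
Unset Strict Implicit.
Unset Printing Implicit Defensive.
Import GRing.Theory Num.Theory.
Local Open Scope ring_scope.

Definition l2norm (R : rcfType) (n : nat) (u : 'rV[R]_n) : R :=
  Num.sqrt (\sum_(j < n) u 0 j ^+ 2).

(* Reweighting matrix of the smoothed l_{2,1} norm: diagonal, with n-th entry
   1 / sqrt (|a^n|_2^2 + eps), where a^n is the n-th row of A. *)
Definition reweight_mx (R : rcfType) (N : nat) (eps : R) (A : 'M[R]_N)
    : 'M[R]_N :=
  diag_mx (\row_(n < N) (Num.sqrt (l2norm (row n A) ^+ 2 + eps))^-1).

(* Main.v *)
(* Push-through identity: with S = V + beta X^T X, G = V^-1 X^T and
   T = 1 + beta X G one has S G = X^T T, hence S^-1 X^T = G T^-1; both S and T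
   are positive definite, hence invertible. *)
Require Import Defs.
From mathcomp Require Import all_boot all_order all_algebra.
Set Implicit Arguments.
Unset Strict Implicit.
Unset Printing Implicit Defensive.
Import Order.TTheory GRing.Theory Num.Theory.
Local Open Scope ring_scope.

(** Once [S] and [T] are invertible, the intertwining relation S G = X^T T moves the inverse across
    X^T ([invmx_mulmx_eq]). Invertibility of both has one source, [unitmx_diag_add_gram]: a positive
    diagonal matrix plus a nonnegatively weighted Gram matrix has a positive definite quadratic
    form, hence a trivial kernel. *)

Lemma quadratic_form_diag_mx (R : comNzRingType) (n : nat) (d u : 'rV[R]_n) :
  (u *m diag_mx d *m u^T) 0 0 = \sum_j d 0 j * u 0 j ^+ 2.
Proof.
rewrite mul_mx_diag mxE; apply: eq_bigr => j _.
by rewrite !mxE mulrAC mulrC expr2.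
Qed.

(** If u kills the matrix, pairing with u^T gives 0 = sum_j d_j u_j^2 + sum_i w_i (u Y^T)_i^2. Both
    sums are nonnegative, so the first vanishes termwise, and d_j > 0 forces u = 0. *)
Lemma unitmx_diag_add_gram (R : realFieldType) (m n : nat)
    (d : 'rV[R]_n) (w : 'rV[R]_m) (Y : 'M[R]_(m, n)) :
  (forall j, 0 < d 0 j) -> (forall i, 0 <= w 0 i) ->
  diag_mx d + Y^T *m diag_mx w *m Y \in unitmx.
Proof.
move=> d_gt0 w_ge0; rewrite -row_free_unit; apply/inj_row_free => u uS0.
have := congr1 (fun v => (v *m u^T) 0 0) uS0.
have -> : u *m (diag_mx d + Y^T *m diag_mx w *m Y) *m u^T =
    u *m diag_mx d *m u^T + (u *m Y^T) *m diag_mx w *m (u *m Y^T)^T.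
  by rewrite trmx_mul trmxK mulmxDr mulmxDl !mulmxA.
have term_ge0 k (c v : 'rV[R]_k) (c_ge0 : forall i, 0 <= c 0 i) i :
  0 <= c 0 i * v 0 i ^+ 2 by rewrite mulr_ge0 ?sqr_ge0.
have d_ge0 j : 0 <= d 0 j by exact: ltW.
rewrite mul0mx mxE !quadratic_form_diag_mx [RHS]mxE => /eqP.
rewrite paddr_eq0; try by apply: sumr_ge0 => i _; exact: term_ge0.
case/andP=> /eqP du0 _; apply/rowP => j; rewrite mxE; apply/eqP.
have /(_ j isT)/eqP := psumr_eq0P (fun i _ => term_ge0 _ d u d_ge0 i) du0.
by rewrite mulf_eq0 gt_eqF //= sqrf_eq0.
Qed.

Lemma invmx_mulmx_eq (R : comUnitRingType) (m n : nat)
    (S : 'M[R]_m) (T : 'M[R]_n) (B G : 'M[R]_(m, n)) :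
  S \in unitmx -> T \in unitmx -> S *m G = B *m T ->
  invmx S *m B = G *m invmx T.
Proof.
by move=> uS uT SG; rewrite -[B](mulmxK uT) -SG !mulmxA mulVmx // mul1mx.
Qed.

Theorem theorem2 (R : rcfType) (L N : nat) (X P : 'M[R]_(L, N)) (beta eps : R)
    (A0 : 'M[R]_N) (hbeta : 0 <= beta) (heps : 0 < eps) :
  let V := reweight_mx eps A0 in
  [/\ V \in unitmx,
      V + beta *: (X^T *m X) \in unitmx,
      1%:M + beta *: (X *m (X *m invmx V)^T) \in unitmx
    & beta *: (invmx (V + beta *: (X^T *m X)) *m X^T *m P) =
      beta *: ((X *m invmx V)^T
               *m invmx (1%:M + beta *: (X *m (X *m invmx V)^T)) *m P)].
Proof.
rewrite /reweight_mx; set d := (\row_n _).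
have d_gt0 j : 0 < d 0 j.
  by rewrite mxE invr_gt0 sqrtr_gt0 ltr_wpDl ?sqr_ge0.
(* From here on [V] is any diagonal matrix with positive entries; the reweighting formula is
   forgotten. *)
move: d d_gt0 => d d_gt0; set V := diag_mx d.
pose w : 'rV[R]_N := \row_j (d 0 j)^-1.
have VW : V *m diag_mx w = 1%:M.
  rewrite mulmx_diag -diag_const_mx; congr diag_mx.
  by apply/rowP => j; rewrite !mxE divff // gt_eqF.
have uV : V \in unitmx by case: (mulmx1_unit VW).
have invV : invmx V = diag_mx w by rewrite -[RHS](mulKmx uV) VW mulmx1.
have uS : V + beta *: (X^T *m X) \in unitmx.
  have := @unitmx_diag_add_gram R _ _ d (const_mx beta) X d_gt0.
  rewrite diag_const_mx mul_mx_scalar -scalemxAl; apply=> i.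
  by rewrite mxE.
have uT : 1%:M + beta *: (X *m (X *m invmx V)^T) \in unitmx.
  (* With [Y] = X^T the Gram term is X (beta V^-1) X^T; since V^-1 is diagonal, hence symmetric,
     this is beta X (X V^-1)^T. *)
  have := @unitmx_diag_add_gram R _ _ (const_mx 1) (beta *: w) X^T.
  rewrite diag_const_mx trmxK linearZ /= -scalemxAr -scalemxAl.
  rewrite invV trmx_mul tr_diag_mx mulmxA; apply=> i; rewrite !mxE //.
  by rewrite mulr_ge0 // invr_ge0 ltW.
split=> //; congr (_ *: (_ *m P)); apply: invmx_mulmx_eq => //.
(* Both sides expand to X^T + beta X^T X V^-1 X^T. *)
rewrite trmx_mul invV tr_diag_mx mulmxDl mulmxDr mulmx1 mulmxA VW mul1mx.
by rewrite -scalemxAl -scalemxAr !mulmxA.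
Qed.
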